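(* Let $\mathcal{E}=\mathcal{E}(a)=\{\theta\in\ell_2:\ \sum_{i\in\mathbb{N}}(\theta_i/a_i)^2\le 1\}$, and let $t=t(\bar n)$ be defined as the solution of the equation $$\sum_{i\in\mathbb{N}}\frac{\sigma_i^2\,(1-t a_i^{-1})_+}{n_i a_i}=t .$$ The optimal allocation $\bar n_o=\bar n_o(n,\mathcal{E})$ and the optimized risk $R(\bar n_o,\mathcal{E})$ are determined by $$R(\bar n_o,\mathcal{E})=\inf_{\bar n\in\mathcal{N}_n}\ \sum_{i\in\mathbb{N}}\frac{\sigma_i^2}{n_i}\,\bigl(1-t(\bar n)\,a_i^{-1}\bigr)_+ .$$
   Context: Model: one observes independent $X_i\sim N(\theta_i,\sigma_i^2/n_i)$, $i\in\mathbb{N}$, where $\sigma_i\ge\sigma>0$ (without loss of generality $\sigma=1$) and $\theta=(\theta_i)_{i\in\mathbb{N}}\in\Theta\subseteq\ell_2$ is unknown. The vector $\bar n=(n_i)_{i\in\mathbb{N}}$ with real $n_i\ge0$ is called the measurement allocation. The set of allocations satisfying the measurement budget constraint with budget $b$ is $$\mathcal{N}_b=\Bigl\{\bar m=(m_i)_{i\in\mathbb{N}}:\ m_i\ge0,\ \sum_{i\in\mathbb{N}}m_i\le b\Bigr\},$$ and $\mathcal{N}_n$ is this set with $b=n$. The sequence $a=(a_i)_{i\in\mathbb{N}}$ consists of numbers in $[0,+\infty]$ converging to $0$ as $i\to\infty$, and is assumed, without loss of generality, to be strictly positive and nonincreasing. Minimax linear risk over $\Theta\subseteq\ell_2$: $$R(\bar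 n,\Theta)=\inf_{\lambda}\sup_{\theta\in\Theta}\mathrm{E}_\theta\|\hat\theta(\lambda)-\theta\|^2=\inf_{\lambda}\sup_{\theta\in\Theta}\sum_{i\in\mathbb{N}}\Bigl(\frac{\sigma_i^2\lambda_i^2}{n_i}+(1-\lambda_i)^2\theta_i^2\Bigr),$$ where $\hat\theta(\lambda)=(\lambda_iX_i)_{i\in\mathbb{N}}$ is the linear estimator with weights $\lambda=(\lambda_i)_{i\in\mathbb{N}}$ and $\|\cdot\|$ is the $\ell_2$-norm. The optimal allocation $\bar n_o=\bar n_o(n,\Theta)$ over $\Theta$ is defined by $R(\bar n_o,\Theta)=\inf_{\bar n\in\mathcal{N}_n}R(\bar n,\Theta)$, and $R(\bar n_o,\Theta)$ is called the optimized risk. Conventions: $b_+=\max\{b,0\}$ for $b\in\mathbb{R}$; $0/0=0$; $x/(+\infty)=0$ for $x\in\mathbb{R}$.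
   Formalization: The infimum on the right is taken only over allocations in N_n for which the equation for t has a solution (it has none, e.g., if a_1 is finite and n_1 = 0), and the budget n is assumed positive; the optimized risk on the left is still over all of N_n. *)

(* Defs.v *)
From mathcomp Require Import all_boot all_order all_algebra.
From mathcomp Require Import all_classical all_reals all_analysis measurable_realfun.
Import Order.TTheory GRing.Theory Num.Theory numFieldNormedType.Exports.

Set Implicit Arguments.
Unset Strict Implicit.
Unset Printing Implicit Defensive.

Local Open Scope classical_set_scope.
Local Open Scope ring_scope.
Local Open Scope ereal_scope.

(* Gaussian sequence model: independent X_i ~ N(theta_i, sigma_i^2 / m_i),
   where m is the measurement allocation.  Sequences are indexed from 0.

   Division is that of [\bar R]: x / +oo = 0 for real x, 0 / 0 = 0 and
   x / 0 = +oo for x > 0.  All the series below have nonnegative terms in the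
   situations of interest, so they always have a value in [0, +oo]. *)

Definition ell2 (R : realType) : set (nat -> R) :=
  [set theta | \sum_(i <oo) (theta i ^+ 2)%:E < +oo].

Definition allocations (R : realType) (b : R) : set (nat -> R) :=
  [set m | (forall i, (0 <= m i)%R) /\ \sum_(i <oo) (m i)%:E <= b%:E].

(* The quadratic risk E_theta || (lambda_i X_i)_i - theta ||^2 of the linear
   estimator with weights lambda, in its variance + squared bias form (see
   [linear_riskE]), which also makes sense when m_i = 0: such a coordinate
   contributes theta_i^2 if lambda_i = 0, and +oo otherwise (if sigma_i > 0). *)
Definition linear_risk (R : realType) (sigma m lambda theta : nat -> R)
    : \bar R :=
  \sum_(i <oo) ((sigma i ^+ 2 * lambda i ^+ 2)%:E / (m i)%:E
                + ((1 - lambda i) ^+ 2 * theta i ^+ 2)%:E).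

Lemma linear_riskE (R : realType) d (T : measurableType d)
    (P : probability T R) (X : nat -> {RV P >-> R})
    (sigma m lambda theta : nat -> R) :
  (forall i, (X i : T -> R) \in Lfun P 2%:E) ->
  (forall i, 'E_P[X i] = (theta i)%:E) ->
  (forall i, 'V_P[X i] = (sigma i ^+ 2 / m i)%:E) ->
  (forall i, (0 < m i)%R) ->
  \int[P]_w (\sum_(i <oo) ((lambda i * X i w - theta i) ^+ 2)%:E)
  = linear_risk sigma m lambda theta.
Proof.
move=> X2 EX VX m_gt0.
pose Z i : T -> R := ((lambda i \o* X i) \- cst (theta i))%R.
have ZE i w : (Z i w ^+ 2 = (lambda i * X i w - theta i) ^+ 2)%R.
  by rewrite /Z/= [(X i w * _)%R]mulrC.
have Pfin : P [set: T] \is a fin_num by exact: fin_num_measure.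
rewrite integral_nneseries//=; first last.
- by move=> i w _; rewrite lee_fin sqr_ge0.
- move=> i; apply/measurable_EFinP; apply: measurable_funX.
  by apply: measurable_funB => //; apply: measurable_funM.
apply: eq_eseriesr => i _.
have lX2 : (lambda i \o* X i)%R \in Lfun P 2%:E by rewrite Lfun_scale ?ler1n.
have Z2 : Z i \in Lfun P 2%:E by rewrite rpredB ?lee1n//= => ?; rewrite Lfun_cst.
have EZ : 'E_P[Z i] = ((lambda i - 1) * theta i)%:E.
  rewrite expectationB ?Lfun_cst ?(Lfun_subset12 Pfin)//.
  rewrite expectationZl ?(Lfun_subset12 Pfin)// EX expectation_cst.
  by rewrite -EFinM -EFinB mulrBl mul1r.
have VZ : 'V_P[Z i] = (lambda i ^+ 2 * (sigma i ^+ 2 / m i))%:E.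
  by rewrite varianceB_cst_r// varianceZ// VX.
have -> : \int[P]_w ((lambda i * X i w - theta i) ^+ 2)%:E
    = 'V_P[Z i] + 'E_P[Z i] ^+ 2.
  rewrite varianceE// EZ subeK// unlock.
  by apply: eq_integral => w _; rewrite -ZE.
rewrite VZ EZ -EFin_expe -EFinD.
rewrite inver gt_eqF// -!EFinM -!EFinD; congr (_%:E); congr +%R.
  by rewrite mulrCA mulrA.
by rewrite exprMn -[in LHS]sqrrN opprB.
Qed.

Definition minimax_linear_risk (R : realType) (sigma m : nat -> R)
    (Theta : set (nat -> R)) : \bar R :=
  ereal_inf [set ereal_sup [set linear_risk sigma m lambda theta
                           | theta in Theta]
            | lambda in [set: nat -> R]].

Definition optimized_risk (R : realType) (sigma : nat -> R) (b : R)
    (Theta : set (nat -> R)) : \bar R :=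
  ereal_inf [set minimax_linear_risk sigma m Theta | m in allocations b].

Definition optimal_allocation (R : realType) (sigma : nat -> R) (b : R)
    (Theta : set (nat -> R)) : set (nat -> R) :=
  [set m | allocations b m /\
           minimax_linear_risk sigma m Theta = optimized_risk sigma b Theta].

Definition ellipsoid (R : realType) (a : nat -> \bar R) : set (nat -> R) :=
  [set theta | ell2 theta /\ \sum_(i <oo) ((theta i)%:E / a i) ^+ 2 <= 1].

Definition pinsker_weight (R : realType) (a : nat -> \bar R) (t : R) (i : nat)
    : \bar R :=
  maxe (1 - t%:E * (a i)^-1) 0.

(* t = t(m).  A relation and not a function, because the equation need not be
   solvable when some m_i vanish.  For example, if a is nonincreasing, a_0 is
   finite and m_0 = 0, then the left-hand side is +oo for t < a_0 and 0 for
   t >= a_0.  There the formula below also cannot be the risk: t = a_0 would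
   give 0, whereas the risk is at least a_0^2. *)
Definition pinsker_eq (R : realType) (sigma m : nat -> R) (a : nat -> \bar R)
    (t : R) : Prop :=
  \sum_(i <oo) (sigma i ^+ 2)%:E * pinsker_weight a t i / ((m i)%:E * a i)
  = t%:E.

Definition pinsker_value (R : realType) (sigma m : nat -> R)
    (a : nat -> \bar R) (t : R) : \bar R :=
  \sum_(i <oo) (sigma i ^+ 2)%:E / (m i)%:E * pinsker_weight a t i.

(* The infimum is over the allocations m for which t(m) exists; these include
   every m with all m_i > 0 as soon as sigma and a are positive and a tends
   to 0. *)
Definition pinsker_inf (R : realType) (sigma : nat -> R) (b : R)
    (a : nat -> \bar R) : \bar R :=
  ereal_inf [set v | exists m t, [/\ allocations b m, pinsker_eq sigma m a t
                                  & v = pinsker_value sigma m a t]].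

(* Main.v *)
Require Import Defs.
From mathcomp Require Import all_boot all_order all_algebra.
From mathcomp Require Import all_classical all_reals all_analysis.
From mathcomp Require Import ring.
Import Order.TTheory GRing.Theory Num.Theory numFieldNormedType.Exports.

(** Two facts together give the theorem.

    First, for a fixed allocation [m] for which t(m) exists, the minimax linear
    risk over the ellipsoid is Pinsker's value ([minimax_pinsker]).  This is a
    saddle point argument.  With the Pinsker weights w_i = (1 - t / a_i)_+ the
    bias is controlled by (1 - w_i)^2 theta_i^2 <= t^2 (theta_i / a_i)^2, so the
    risk at every theta is at most sum_i sigma_i^2 w_i^2 / m_i + t^2, and the
    equation for t turns this bound into the value ([pinsker_upper]).
    Conversely, the point with theta_i^2 = sigma_i^2 w_i a_i / (m_i t) lies on the
    boundary of the ellipsoid, again by the equation for t, and w_i is the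
    coordinatewise optimal weight there; hence no lambda has a smaller maximal
    risk ([pinsker_lower]).  A coordinate with a_i = +oo is unconstrained: it
    forces lambda_i = 1, or else the maximal risk is infinite.

    Second, the allocations for which t(m) fails to exist do not change the
    infimum.  If all the m_i are positive, then t(m) exists by the intermediate
    value theorem ([pinsker_eq_solvable]).  An arbitrary allocation m is
    approached by the positive allocations m' = c m + (1 - c) mu, where c < 1
    and mu is a positive allocation ([positive_allocation]).  As m' >= c m, each
    variance grows by a factor at most 1 / c, so that c R(m') <= R(m)
    ([minimax_scale]); it remains to let c tend to 1 ([optimized_riskE]). *)

Set Implicit Arguments.
Unset Strict Implicit.
Unset Printing Implicit Defensive.

Local Open Scope classical_set_scope.
Local Open Scope ring_scope.
Local Open Scope ereal_scope.

(** * Series of extended reals *)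

Lemma nneseries_term_le (R : realType) (F : nat -> \bar R) (i : nat) :
  (forall k, 0 <= F k) -> F i <= \sum_(k <oo) F k.
Proof.
move=> F0; apply: le_trans (nneseries_lim_ge i.+1 (fun k _ _ => F0 k)).
by rewrite big_nat_recr//= leeDr// sume_ge0.
Qed.

Lemma eseries_finite_support (R : realType) (F : nat -> \bar R) (N : nat) :
  (forall i, (N <= i)%N -> F i = 0) ->
  \sum_(i <oo) F i = \sum_(0 <= i < N) F i.
Proof.
move=> F0; apply: lim_near_cst => //.
near=> k.
have Nk : (N <= k)%N by near: k; exact: nbhs_infty_ge.
have tail0 : \sum_(N <= i < k) F i = 0.
  by rewrite big_nat big1// => i /andP[Ni _]; exact: F0.
by rewrite (big_cat_nat (n := N))//= tail0 adde0.
Unshelve. all: by end_near. Qed.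

(** * Pinsker weights and the equation for t in real numbers *)

(** [fine +oo = 0] and [0^-1 = 0] in a field, so an infinite axis gets inverse 0
    and every formula involving 1 / a_i becomes a formula in [R]. *)
Definition inv_axis (R : realType) (a : nat -> \bar R) (i : nat) : R :=
  ((fine (a i))^-1)%R.

Lemma inv_axisE (R : realType) (a : nat -> \bar R) (i : nat) :
  0 < a i -> (a i)^-1 = (inv_axis a i)%:E.
Proof.
rewrite /inv_axis; case: (a i) => [r| |]//=.
  by rewrite lte_fin => r0; rewrite inver gt_eqF.
by rewrite invey invr0.
Qed.

Lemma inv_axis_ge0 (R : realType) (a : nat -> \bar R) (i : nat) :
  0 < a i -> (0 <= inv_axis a i)%R.
Proof. by move=> a0; rewrite invr_ge0 fine_ge0// ltW. Qed.

Definition weight (R : realType) (a : nat -> \bar R) (t : R) (i : nat) : R :=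
  Num.max (1 - t * inv_axis a i)%R 0%R.

Lemma pinsker_weightE (R : realType) (a : nat -> \bar R) (t : R) (i : nat) :
  0 < a i -> pinsker_weight a t i = (weight a t i)%:E.
Proof.
by move=> a0; rewrite /pinsker_weight inv_axisE// /weight EFin_max.
Qed.

Lemma weight_ge0 (R : realType) (a : nat -> \bar R) (t : R) (i : nat) :
  (0 <= weight a t i)%R.
Proof. by rewrite le_max lexx orbT. Qed.

Lemma weight_gt0E (R : realType) (a : nat -> \bar R) (t : R) (i : nat) :
  (0 < weight a t i)%R -> weight a t i = (1 - t * inv_axis a i)%R.
Proof. by rewrite /weight lt_max ltxx orbF => h; apply/max_idPl/ltW. Qed.

(** Since a tends to 0, the weights for a positive t have finite support. *)
Lemma weight_eventually0 (R : realType) (a : nat -> \bar R) (t : R) :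
  (forall i, 0 < a i) -> a @ \oo --> (0 : \bar R) -> (0 < t)%R ->
  exists N, forall i, (N <= i)%N -> (1 <= t * inv_axis a i)%R.
Proof.
move=> a0 acvg t0.
have : \forall i \near \oo, a i < t%:E.
  by apply: (acvg [set x | x < t%:E]); apply: open_ereal_lt'; rewrite lte_fin.
case=> N _ HN; exists N => i Ni.
have := HN i Ni; have := a0 i; rewrite /inv_axis /=.
case: (a i) => [r| |]//=; rewrite !lte_fin => r0 rt.
by rewrite ler_pdivlMr// mul1r ltW.
Qed.

(** The conventions 0 / 0 = 0 for extended reals and 0^-1 = 0 for reals agree
    as long as no nonzero number is divided by 0. *)
Lemma ediv_fin (R : realType) (x y : R) :
  (0 <= x)%R -> (0 <= y)%R -> ((0 < x)%R -> (0 < y)%R) ->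
  x%:E / y%:E = (x / y)%:E.
Proof.
move=> x0 y0 xy; have [{}x0|x0'] := ltP 0%R x.
  by rewrite inver gt_eqF ?xy.
have -> : x = 0%R by apply/le_anti/andP.
by rewrite mul0e mul0r.
Qed.

Lemma pinsker_eq_termE (R : realType) (sigma m : nat -> R)
    (a : nat -> \bar R) (t : R) (i : nat) :
  0 < a i -> (0 <= m i)%R -> ((0 < weight a t i)%R -> (0 < m i)%R) ->
  (sigma i ^+ 2)%:E * pinsker_weight a t i / ((m i)%:E * a i)
  = (sigma i ^+ 2 * weight a t i * inv_axis a i / m i)%:E.
Proof.
move=> a0 m0 wm; rewrite pinsker_weightE// -EFinM.
have [w0|w0] := ltP 0%R (weight a t i); last first.
  have -> : weight a t i = 0%R by apply/le_anti; rewrite w0 weight_ge0.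
  by rewrite !(mulr0, mul0r) mul0e.
have {}m0 := wm w0.
rewrite /inv_axis; case: (a i) a0 => [r| |]//= r0.
  rewrite lte_fin in r0.
  rewrite -EFinM inver gt_eqF ?mulr_gt0// -EFinM invfM; congr EFin; ring.
by rewrite gt0_muley ?lte_fin// invey mule0 invr0 mulr0 mul0r.
Qed.

Lemma pinsker_real_term_ge0 (R : realType) (sigma m : nat -> R)
    (a : nat -> \bar R) (t : R) (i : nat) :
  0 < a i -> (0 <= m i)%R ->
  (0 <= sigma i ^+ 2 * weight a t i * inv_axis a i / m i)%R.
Proof.
move=> a0 m0; rewrite divr_ge0// mulr_ge0 ?inv_axis_ge0//.
by rewrite mulr_ge0 ?sqr_ge0 ?weight_ge0.
Qed.

Lemma pinsker_eq_term_ge0 (R : realType) (sigma m : nat -> R)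
    (a : nat -> \bar R) (t : R) (i : nat) :
  0 < a i -> (0 <= m i)%R ->
  0 <= (sigma i ^+ 2)%:E * pinsker_weight a t i / ((m i)%:E * a i).
Proof.
move=> a0 m0; rewrite pinsker_weightE// -EFinM mule_ge0//.
  by rewrite lee_fin mulr_ge0// ?sqr_ge0// weight_ge0.
by rewrite inve_ge0 mule_ge0// ltW.
Qed.

(** A finite t forces m_i > 0 on the support of the weights, since otherwise the
    series is infinite.  Also t = 0 is excluded: all the weights would be 1,
    and a coordinate with finite a_i would make the series positive. *)
Lemma pinsker_eq_real (R : realType) (sigma m : nat -> R)
    (a : nat -> \bar R) (t : R) :
  (forall i, 0 < sigma i)%R -> (forall i, 0 < a i) ->
  a @ \oo --> (0 : \bar R) -> (forall i, 0 <= m i)%R ->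
  pinsker_eq sigma m a t ->
  [/\ (0 < t)%R, forall i, (0 < weight a t i)%R -> (0 < m i)%R &
      \sum_(i <oo) (sigma i ^+ 2 * weight a t i * inv_axis a i / m i)%:E
      = t%:E].
Proof.
move=> s0 a0 acvg m0 E.
have T0 i := pinsker_eq_term_ge0 sigma t (a0 i) (m0 i).
have tge i := nneseries_term_le i T0.
rewrite E in tge.
have wm i : (0 < weight a t i)%R -> (0 < m i)%R.
  move=> w0; rewrite lt0r m0 andbT; apply/eqP => mi0; have := tge i.
  rewrite mi0 mul0e inve0 pinsker_weightE// -EFinM gt0_muley ?leye_eq//.
  by rewrite lte_fin mulr_gt0// exprn_gt0.
have E' : \sum_(i <oo) (sigma i ^+ 2 * weight a t i * inv_axis a i / m i)%:E
      = t%:E.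
  by rewrite -E; apply: eq_eseriesr => i _; rewrite pinsker_eq_termE//; exact: wm.
split => //.
have t0 : (0 <= t)%R by rewrite -lee_fin -E nneseries_ge0.
rewrite lt0r t0 andbT; apply/eqP => tz.
have [N HN] := weight_eventually0 a0 acvg (@ltr01 R).
have := HN N (leqnn N); rewrite mul1r => al1.
have w1 : weight a t N = 1%R.
  by rewrite /weight tz mul0r subr0; apply/max_idPl.
have mN : (0 < m N)%R by apply: wm; rewrite w1 ltr01.
have := tge N; rewrite pinsker_eq_termE//.
rewrite lee_fin leNgt => /negP; apply.
rewrite w1 mulr1 tz divr_gt0// mulr_gt0 ?exprn_gt0//.
exact: lt_le_trans al1.
Qed.

Lemma pinsker_valueE (R : realType) (sigma m : nat -> R)
    (a : nat -> \bar R) (t : R) :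
  (forall i, 0 < sigma i)%R -> (forall i, 0 < a i) ->
  (forall i, 0 < weight a t i -> 0 < m i)%R ->
  pinsker_value sigma m a t
  = \sum_(i <oo) (sigma i ^+ 2 * weight a t i / m i)%:E.
Proof.
move=> s0 a0 wm; apply: eq_eseriesr => i _; rewrite pinsker_weightE//.
have [w0|w0] := ltP 0%R (weight a t i); last first.
  have -> : weight a t i = 0%R by apply/le_anti; rewrite w0 weight_ge0.
  by rewrite mule0 mulr0 mul0r.
by rewrite inver gt_eqF ?wm// -!EFinM mulrAC.
Qed.

Lemma pinsker_value_ge0 (R : realType) (sigma m : nat -> R)
    (a : nat -> \bar R) (t : R) :
  (forall i, 0 <= m i)%R -> 0 <= pinsker_value sigma m a t.
Proof.
move=> m0; apply: nneseries_ge0 => i _ _.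
by rewrite !mule_ge0 ?inve_ge0 ?lee_fin ?sqr_ge0// le_max lexx orbT.
Qed.

Lemma ellipsoid_sumE (R : realType) (a : nat -> \bar R) (theta : nat -> R) :
  (forall i, 0 < a i) ->
  \sum_(i <oo) ((theta i)%:E / a i) ^+ 2
  = \sum_(i <oo) ((theta i * inv_axis a i) ^+ 2)%:E.
Proof.
by move=> a0; apply: eq_eseriesr => i _; rewrite inv_axisE// -EFinM EFin_expe.
Qed.

(** * Saddle point: the minimax linear risk at a fixed allocation *)

Lemma variance_term_ge0 (R : realType) (s l m : R) :
  (0 <= m)%R -> 0 <= (s ^+ 2 * l ^+ 2)%:E / m%:E.
Proof.
by move=> m0; rewrite mule_ge0 ?inve_ge0 ?lee_fin// -exprMn sqr_ge0.
Qed.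

Lemma linear_risk_term_ge0 (R : realType) (s l m th : R) :
  (0 <= m)%R ->
  0 <= (s ^+ 2 * l ^+ 2)%:E / m%:E + ((1 - l) ^+ 2 * th ^+ 2)%:E.
Proof.
by move=> m0; rewrite adde_ge0 ?variance_term_ge0// lee_fin -exprMn sqr_ge0.
Qed.

(** By the equation for t, t^2 = t * sum_i sigma_i^2 w_i / (m_i a_i), and
    w_i + t / a_i = 1 wherever w_i > 0; this merges the variance of the Pinsker
    estimator and the bound t^2 on its bias into Pinsker's value. *)
Lemma pinsker_upper (R : realType) (sigma m : nat -> R)
    (a : nat -> \bar R) (t : R) :
  (forall i, 0 < sigma i)%R -> (forall i, 0 < a i) ->
  a @ \oo --> (0 : \bar R) -> (forall i, 0 <= m i)%R ->
  pinsker_eq sigma m a t ->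
  forall theta, ellipsoid a theta ->
  linear_risk sigma m (weight a t) theta <= pinsker_value sigma m a t.
Proof.
move=> s0 a0 acvg m0 E theta [_ thE].
have [t0 wm E'] := pinsker_eq_real s0 a0 acvg m0 E.
rewrite pinsker_valueE//; rewrite ellipsoid_sumE// in thE.
have al0 i := inv_axis_ge0 (a0 i).
pose w := weight a t.
have w0 i : (0 <= w i)%R by exact: weight_ge0.
pose V i := (sigma i ^+ 2 * w i ^+ 2 / m i)%R.
have V0 i : (0 <= V i)%R by rewrite divr_ge0// mulr_ge0 ?sqr_ge0.
apply: (@le_trans _ _ (\sum_(i <oo)
   ((V i)%:E + (t ^+ 2)%:E * ((theta i * inv_axis a i) ^+ 2)%:E))).
  apply: lee_nneseries => i _; first by move=> _; exact: linear_risk_term_ge0.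
  rewrite ediv_fin//; first 1 last.
  - by rewrite -exprMn sqr_ge0.
  - move=> h; apply: wm; rewrite lt0r weight_ge0 andbT.
    by apply: contraTneq h => ->; rewrite expr0n mulr0 ltxx.
  rewrite leeD2l// -EFinM lee_fin [leRHS](_ : _
    = (t * inv_axis a i) ^+ 2 * theta i ^+ 2)%R; last first.
    by rewrite -!exprMn; congr (_ ^+ _)%R; ring.
  have ta : (0 <= t * inv_axis a i)%R by rewrite mulr_ge0// ltW.
  rewrite ler_wpM2r ?sqr_ge0// lerXn2r ?nnegrE//.
    by rewrite subr_ge0 ge_max lerBlDr lerDl ta ler01.
  by rewrite lerBlDr -lerBlDl le_max lexx.
rewrite nneseriesD; [|by move=> *; rewrite lee_fin|]; last first.
  by move=> *; rewrite -EFinM lee_fin mulr_ge0 ?sqr_ge0.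
rewrite nneseriesZl; last by move=> *; rewrite lee_fin sqr_ge0.
apply: (@le_trans _ _ (\sum_(i <oo) (V i)%:E + t%:E * t%:E)).
  rewrite leeD2l// -EFinM -expr2 -[leRHS]mule1 lee_wpmul2l//.
  by rewrite lee_fin sqr_ge0.
rewrite -[X in _ * X]E' -nneseriesZl; last first.
  by move=> i _; rewrite lee_fin pinsker_real_term_ge0.
rewrite -nneseriesD; [|by move=> *; rewrite lee_fin|]; last first.
  move=> i _ _; rewrite -EFinM lee_fin mulr_ge0 ?(ltW t0)//.
  by rewrite pinsker_real_term_ge0.
rewrite le_eqVlt; apply/orP; left; apply/eqP.
apply: eq_eseriesr => i _; rewrite -EFinM -EFinD; congr EFin.
rewrite /V -/w.
have [wi0|wi0] := ltP 0%R (w i); last first.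
  have -> : w i = 0%R by apply/le_anti; rewrite wi0 w0.
  by rewrite expr0n /= !(mulr0,mul0r) addr0.
have e : (1 = w i + t * inv_axis a i)%R by rewrite /w weight_gt0E// subrK.
rewrite -[RHS]mulr1 [X in _ = (_ * X)%R]e; ring.
Qed.

(** Exhibits, for each lambda, one point of the ellipsoid with large risk: far
    out on an infinite axis if lambda_i <> 1 there, and otherwise the least
    favorable point.  There, a coordinate with w_i > 0 and finite a_i exceeds
    its share of Pinsker's value by sigma_i^2 / (m_i u) * (lambda_i - w_i)^2,
    where u = t / a_i = 1 - w_i. *)
Lemma pinsker_lower (R : realType) (sigma m : nat -> R)
    (a : nat -> \bar R) (t : R) :
  (forall i, 0 < sigma i)%R -> (forall i, 0 < a i) ->
  a @ \oo --> (0 : \bar R) -> (forall i, 0 <= m i)%R ->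
  pinsker_eq sigma m a t ->
  forall lambda, pinsker_value sigma m a t <=
    ereal_sup [set linear_risk sigma m lambda theta | theta in ellipsoid a].
Proof.
move=> s0 a0 acvg m0 E lambda.
have [t0 wm E'] := pinsker_eq_real s0 a0 acvg m0 E.
have al0 i := inv_axis_ge0 (a0 i).
have supge theta : ellipsoid a theta -> linear_risk sigma m lambda theta <=
    ereal_sup [set linear_risk sigma m lambda theta | theta in ellipsoid a].
  by move=> th; apply: ereal_sup_ubound; exists theta.
have [lam1|] := pselect (forall i, inv_axis a i = 0%R -> lambda i = 1%R); last first.
  move=> /existsNP[i] /not_implyP[ali lami].
  suff -> : ereal_sup [set linear_risk sigma m lambda theta | theta in ellipsoid a]
      = +oo by rewrite leey.
  apply/eqyP => A A0.
  (* The squared bias of coordinate i alone is A. *)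
  pose theta j : R := if j == i then (Num.sqrt A / (1 - lambda i))%R else 0%R.
  apply: le_trans (supge theta _); last first.
    split; last first.
      rewrite ellipsoid_sumE// eseries0// => j _ _; rewrite /theta.
      by case: eqP => [->|_]; rewrite ?ali ?mulr0 ?mul0r expr0n.
    rewrite /ell2 /= (@eseries_finite_support _ _ i.+1); last first.
      by move=> j ij; rewrite /theta gtn_eqF// expr0n.
    by rewrite sumEFin ltry.
  apply: le_trans (nneseries_term_le i _); last first.
    by move=> j; exact: linear_risk_term_ge0.
  rewrite -[leLHS]add0e leeD ?variance_term_ge0//.
  rewrite lee_fin /theta eqxx expr_div_n sqr_sqrtr ?(ltW A0)// mulrC divfK//.
  by rewrite expf_eq0/= subr_eq0 eq_sym; exact/eqP.
pose w := weight a t.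
have w0 i : (0 <= w i)%R by exact: weight_ge0.
(* Where a_i is infinite or m_i = 0 the divisor is 0, and so is theta i. *)
pose theta i : R := Num.sqrt (sigma i ^+ 2 * w i / (m i * t * inv_axis a i)).
have theta2 i : (theta i ^+ 2 = sigma i ^+ 2 * w i / (m i * t * inv_axis a i))%R.
  rewrite sqr_sqrtr// divr_ge0//; first by rewrite mulr_ge0// sqr_ge0.
  by rewrite !mulr_ge0// ltW.
apply: le_trans (supge theta _); last first.
  split.
    have [N HN] := weight_eventually0 a0 acvg t0.
    rewrite /ell2 /= (@eseries_finite_support _ _ N); last first.
      move=> j Nj; rewrite theta2 /w /weight.
      have -> : Num.max (1 - t * inv_axis a j)%R 0%R = 0%R.
        by apply/max_idPr; rewrite subr_le0 HN.
      by rewrite mulr0 mul0r.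
    by rewrite sumEFin ltry.
  rewrite ellipsoid_sumE//.
  rewrite (@eq_eseriesr _ _ (fun i => (t^-1)%:E *
    (sigma i ^+ 2 * weight a t i * inv_axis a i / m i)%:E)); last first.
    move=> i _; rewrite -EFinM exprMn theta2 -/w; congr EFin.
    have [->|ali] := eqVneq (inv_axis a i) 0%R.
      by rewrite expr0n/= !(mulr0, mul0r).
    rewrite !invfM [X in (_ * X)%R = _]expr2.
    rewrite -[in RHS](mulfK ali (inv_axis a i)); ring.
  rewrite nneseriesZl ?E' -?EFinM ?mulVf ?gt_eqF//.
  by move=> i _; rewrite lee_fin pinsker_real_term_ge0.
apply: lee_nneseries => i _.
  move=> _; rewrite pinsker_weightE// mule_ge0//.
  - by rewrite mule_ge0 ?inve_ge0 ?lee_fin// sqr_ge0.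
  - by rewrite lee_fin.
rewrite pinsker_weightE//.
have [wi0|wi0] := ltP 0%R (w i); last first.
  have -> : weight a t i = 0%R by apply/le_anti; rewrite wi0 w0.
  by rewrite mule0 linear_risk_term_ge0.
have mi := wm _ wi0.
rewrite inver gt_eqF// -!EFinM -EFinD lee_fin theta2 /w weight_gt0E//.
have [ali|ali] := eqVneq (inv_axis a i) 0%R.
  by rewrite lam1// ali !(mulr0, invr0, subr0, addr0, mulr1, expr1n).
have {}ali : (0 < inv_axis a i)%R by rewrite lt0r ali al0.
have : (0 < 1 - t * inv_axis a i)%R by rewrite -weight_gt0E.
have : (0 < t * inv_axis a i)%R by rewrite mulr_gt0.
have -> : (m i * t * inv_axis a i = m i * (t * inv_axis a i))%R by rewrite mulrA.
move: (t * _)%R => u u0 u1.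
rewrite -subr_ge0 [leRHS](_ : _ =
   sigma i ^+ 2 / (m i * u) * (lambda i - (1 - u)) ^+ 2)%R; last first.
  by field; rewrite !gt_eqF.
by rewrite mulr_ge0 ?sqr_ge0// divr_ge0 ?sqr_ge0// mulr_ge0 ?ltW.
Qed.

Theorem minimax_pinsker (R : realType) (sigma m : nat -> R)
    (a : nat -> \bar R) (t : R) :
  (forall i, 0 < sigma i)%R -> (forall i, 0 < a i) ->
  a @ \oo --> (0 : \bar R) -> (forall i, 0 <= m i)%R ->
  pinsker_eq sigma m a t ->
  minimax_linear_risk sigma m (ellipsoid a) = pinsker_value sigma m a t.
Proof.
move=> s0 a0 acvg m0 E; apply/le_anti/andP; split.
  apply: le_trans (_ : ereal_sup [set linear_risk sigma m (weight a t) theta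
    | theta in ellipsoid a] <= _); first by apply: ereal_inf_lbound; exists (weight a t).
  by apply: ge_ereal_sup => _ [theta th <-]; exact: pinsker_upper.
by apply: le_ereal_inf_tmp => _ [lambda _ <-]; exact: pinsker_lower.
Qed.

(** * Existence of t for positive allocations *)

Lemma weight_continuous (R : realType) (a : nat -> \bar R) (i : nat) :
  continuous (fun t : R => weight a t i).
Proof.
move=> t; apply: (@continuous_max R R (fun t => 1 - t * inv_axis a i)%R (fun=> 0%R)).
  by apply: cvgB; [exact: cvg_cst|apply: cvgM => //; exact: cvg_cst].
exact: cvg_cst.
Qed.

Lemma weight_antitone (R : realType) (a : nat -> \bar R) (i : nat) (s t : R) :
  0 < a i -> (s <= t)%R -> (weight a t i <= weight a s i)%R.
Proof.
move=> a0 st; rewrite /weight ge_max !le_max lexx orbT andbT.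
by rewrite lerB// ler_wpM2r// inv_axis_ge0.
Qed.

(** The left-hand side F of the equation is continuous and nonincreasing.  A
    point [t0] with t0 <= F t0 comes from one coordinate k with finite a_k, and
    then F (F t0) <= F t0, so [t0, F t0] contains a fixed point of F. *)
Lemma pinsker_eq_solvable (R : realType) (sigma m : nat -> R)
    (a : nat -> \bar R) :
  (forall i, 0 < sigma i)%R -> (forall i, 0 < a i) ->
  a @ \oo --> (0 : \bar R) -> (forall i, 0 < m i)%R ->
  exists t, pinsker_eq sigma m a t.
Proof.
move=> s0 a0 acvg m0.
have al0 i := inv_axis_ge0 (a0 i).
have [k /(_ k (leqnn k)) alk] := weight_eventually0 a0 acvg (@ltr01 R).
rewrite mul1r in alk.
have {}alk : (0 < inv_axis a k)%R by exact: lt_le_trans alk.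
(* t0 solves c (1 - t0 / a_k) = t0, the equation reduced to coordinate k. *)
pose c := (sigma k ^+ 2 * inv_axis a k / m k)%R.
have c0 : (0 < c)%R by rewrite divr_gt0// mulr_gt0 ?exprn_gt0.
pose t0 := (c / (1 + c * inv_axis a k))%R.
have d0 : (0 < 1 + c * inv_axis a k)%R by rewrite addr_gt0// mulr_gt0.
have t00 : (0 < t0)%R by rewrite divr_gt0.
have [N HN] := weight_eventually0 a0 acvg t00.
pose T t i := (sigma i ^+ 2 * weight a t i * inv_axis a i / m i)%R.
(* Beyond N all the weights vanish for t >= t0; k.+1 keeps coordinate k. *)
pose M := maxn N k.+1.
pose F t := (\sum_(0 <= i < M) T t i)%R.
have T0 t i : (0 <= T t i)%R.
  by rewrite pinsker_real_term_ge0// ltW.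
have Fcont : continuous F.
  apply: continuous_big => [|i _]; first exact: add_continuous.
  move=> t; apply: cvgM; last exact: cvg_cst.
  apply: cvgM; last exact: cvg_cst.
  by apply: cvgM; [exact: cvg_cst|exact: weight_continuous].
have Fanti s t : (s <= t)%R -> (F t <= F s)%R.
  move=> st; apply: ler_sum => i _.
  rewrite ler_wpM2r ?invr_ge0 ?(ltW (m0 i))// ler_wpM2r// ler_wpM2l ?sqr_ge0//.
  exact: weight_antitone.
have t0F : (t0 <= F t0)%R.
  apply: (@le_trans _ _ (T t0 k)).
    have : (c * (1 - t0 * inv_axis a k) <= T t0 k)%R.
      rewrite /T [leRHS](_ : _ = c * weight a t0 k)%R; last by rewrite /c; ring.
      by rewrite ler_wpM2l ?(ltW c0)// le_max lexx.
    apply: le_trans; rewrite le_eqVlt; apply/orP; left; apply/eqP.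
    by rewrite /t0; field; rewrite gt_eqF.
  rewrite /F (big_cat_nat (n := k.+1))//= ?leq_maxr//.
  by rewrite big_nat_recr//= addrAC lerDr addr_ge0// sumr_ge0.
have gcont : continuous (fun t => F t - t)%R.
  by move=> t; apply: cvgB; [exact: Fcont|exact: cvg_id].
have [|t /itvP tI Ft] := @IVT R (fun t => F t - t)%R _ _ 0%R t0F
    (continuous_subspaceT gcont).
  by rewrite ge_min le_max !subr_ge0 !subr_le0 t0F (Fanti _ _ t0F) orbT.
exists t; rewrite /pinsker_eq.
have {}Ft : F t = t by apply/eqP; rewrite -subr_eq0 Ft.
rewrite -[in RHS]Ft /F -sumEFin -eseries_finite_support.
  by apply: eq_eseriesr => i _; rewrite pinsker_eq_termE// ltW.
move=> i Mi; rewrite /T /weight.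
have -> : Num.max (1 - t * inv_axis a i)%R 0%R = 0%R.
  apply/max_idPr; rewrite subr_le0.
  apply: le_trans (HN i (leq_trans (leq_maxl _ _) Mi)) _.
  by rewrite ler_wpM2r// tI.
by rewrite mulr0 !mul0r.
Qed.

(** * Reduction to positive allocations *)

(** Shrinking an allocation by a factor c multiplies the variances by 1 / c and
    leaves the bias unchanged. *)
Lemma linear_risk_scale (R : realType) (sigma m m' lambda theta : nat -> R)
    (c : R) :
  (0 < c <= 1)%R -> (forall i, 0 <= m i)%R -> (forall i, 0 < m' i)%R ->
  (forall i, c * m i <= m' i)%R ->
  c%:E * linear_risk sigma m' lambda theta <= linear_risk sigma m lambda theta.
Proof.
move=> /andP[c0 c1] m0 m'0 cm.
rewrite -nneseriesZl; last first.
  by move=> i _; rewrite linear_risk_term_ge0 ?ltW.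
apply: lee_nneseries => i _.
  by move=> _; rewrite mule_ge0 ?lee_fin ?(ltW c0)// linear_risk_term_ge0 ?ltW.
have b0 : (0 <= (1 - lambda i) ^+ 2 * theta i ^+ 2)%R by rewrite mulr_ge0 ?sqr_ge0.
have v0 : (0 <= sigma i ^+ 2 * lambda i ^+ 2)%R by rewrite mulr_ge0 ?sqr_ge0.
rewrite inver gt_eqF// -EFinM mulrDr EFinD leeD//; last first.
  by rewrite lee_fin ler_piMl.
have [mi0|mi0] := ltP 0%R (m i); last first.
  have -> : m i = 0%R by apply/le_anti; rewrite mi0 m0.
  have [v00|v00] := eqVneq (sigma i ^+ 2 * lambda i ^+ 2)%R 0%R.
    by rewrite v00 mul0r mulr0 mul0e.
  by rewrite inve0 gt0_muley ?leey// lte_fin lt0r v00.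
rewrite inver gt_eqF// -EFinM lee_fin mulrCA ler_wpM2l//.
by rewrite ler_pdivrMr// mulrC ler_pdivlMr.
Qed.

Lemma minimax_scale (R : realType) (sigma m m' : nat -> R)
    (Theta : set (nat -> R)) (c : R) :
  (0 < c <= 1)%R -> (forall i, 0 <= m i)%R -> (forall i, 0 < m' i)%R ->
  (forall i, c * m i <= m' i)%R ->
  c%:E * minimax_linear_risk sigma m' Theta <= minimax_linear_risk sigma m Theta.
Proof.
move=> c01 m0 m'0 cm; have /andP[c0 _] := c01.
apply: le_ereal_inf_tmp => _ [lambda _ <-].
apply: (@le_trans _ _ (c%:E * ereal_sup
    [set linear_risk sigma m' lambda theta | theta in Theta])).
  rewrite lee_wpmul2l ?lee_fin ?(ltW c0)//.
  by apply: ereal_inf_lbound; exists lambda.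
rewrite -lee_pdivlMl//; apply: ge_ereal_sup => _ [theta th <-].
rewrite lee_pdivlMl//.
apply: le_trans (linear_risk_scale _ _ _ c01 m0 m'0 cm) _.
by apply: ereal_sup_ubound; exists theta.
Qed.

(** Mixes [m] with the positive allocation n / 2^(i+1), whose total is n. *)
Lemma positive_allocation (R : realType) (n c : R) (m : nat -> R) :
  (0 < n)%R -> (0 < c < 1)%R -> allocations n m ->
  exists m', [/\ allocations n m', forall i, (0 < m' i)%R &
    forall i, (c * m i <= m' i)%R].
Proof.
move=> n0 /andP[c0 c1] [m0 mn].
pose mu i : R := (n / (2 ^ i.+1)%:R)%R.
have mu0 i : (0 < mu i)%R by rewrite divr_gt0// ltr0n expn_gt0.
have d0 : (0 < 1 - c)%R by rewrite subr_gt0.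
have cm0 i : (0 <= c * m i)%R by rewrite mulr_ge0// ltW.
have dmu0 i : (0 < (1 - c) * mu i)%R by rewrite mulr_gt0.
exists (fun i => c * m i + (1 - c) * mu i)%R; split; last 2 first.
- by move=> i; rewrite ltr_wpDl.
- by move=> i; rewrite lerDl ltW.
split=> [i|]; first by rewrite addr_ge0// ltW.
rewrite (@eq_eseriesr _ _ (fun i => c%:E * (m i)%:E + (1 - c)%:E * (mu i)%:E));
  last by move=> i _; rewrite -!EFinM -EFinD.
rewrite nneseriesD; last 2 first.
- by move=> i _ _; rewrite -EFinM lee_fin.
- by move=> i _ _; rewrite -EFinM lee_fin ltW.
rewrite !nneseriesZl; last 2 first.
- by move=> i _; rewrite lee_fin ltW.
- by move=> i _; rewrite lee_fin.
have -> : n%:E = c%:E * n%:E + (1 - c)%:E * n%:E.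
  by rewrite -!EFinM -EFinD -mulrDl subrKC mul1r.
by rewrite leeD// lee_wpmul2l ?lee_fin ?(ltW c0) ?(ltW d0)// epsilon_trick0// ltW.
Qed.

(** The nontrivial inequality bounds the risk of an allocation [m] for which
    t(m) may not exist: for each c < 1 it is at least c times the risk of a
    positive allocation, which is a competitor in [pinsker_inf]. *)
Lemma optimized_riskE (R : realType) (sigma : nat -> R) (n : R)
    (a : nat -> \bar R) :
  (forall i, 0 < sigma i)%R -> (forall i, 0 < a i) ->
  a @ \oo --> (0 : \bar R) -> (0 < n)%R ->
  optimized_risk sigma n (ellipsoid a) = pinsker_inf sigma n a.
Proof.
move=> s0 a0 acvg n0; apply/le_anti/andP; split.
  apply: le_ereal_inf_tmp => _ [m [t [mn E ->]]]; have [m0 _] := mn.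
  rewrite -(minimax_pinsker s0 a0 acvg m0 E).
  by apply: ereal_inf_lbound; exists m.
apply: le_ereal_inf_tmp => _ [m mn <-].
have pinf0 : 0 <= pinsker_inf sigma n a.
  by apply: le_ereal_inf_tmp => _ [k [t [[k0 _] _ ->]]]; exact: pinsker_value_ge0.
apply/(lee_mul01Pr _ pinf0) => c c01.
have [m' [m'n m'0 cm]] := positive_allocation n0 c01 mn.
have [t E] := pinsker_eq_solvable s0 a0 acvg m'0.
have /andP[c0 c1] := c01.
apply: le_trans (minimax_scale sigma (ellipsoid a) (c := c) _ _ m'0 cm); last 2 first.
- by rewrite c0 ltW.
- by case: mn.
rewrite lee_wpmul2l ?lee_fin ?(ltW c0)//.
rewrite (minimax_pinsker s0 a0 acvg _ E); last by move=> i; exact: ltW.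
by apply: ereal_inf_lbound; exists m', t.
Qed.

(** * The optimized risk *)

Theorem theorem1 (R : realType) (sigma0 : R) (sigma : nat -> R)
    (a : nat -> \bar R) (n : R)
    (sigma0_gt0 : (0 < sigma0)%R)
    (sigma_ge : forall i : nat, (sigma0 <= sigma i)%R)
    (a_gt0 : forall i : nat, 0 < a i)
    (a_noninc : forall i j : nat, (i <= j)%N -> a j <= a i)
    (a_cvg0 : a @ \oo --> (0 : \bar R))
    (n_gt0 : (0 < n)%R) :
  [/\ optimized_risk sigma n (ellipsoid a) = pinsker_inf sigma n a,
      (forall m : nat -> R,
         optimal_allocation sigma n (ellipsoid a) m <->
         allocations n m /\
         minimax_linear_risk sigma m (ellipsoid a) = pinsker_inf sigma n a)
    & (forall (m : nat -> R) (t : R),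
         allocations n m -> pinsker_eq sigma m a t ->
         (optimal_allocation sigma n (ellipsoid a) m <->
          pinsker_value sigma m a t = pinsker_inf sigma n a))].
Proof.
have sigma_gt0 i : (0 < sigma i)%R by exact: lt_le_trans (sigma_ge i).
have riskE := optimized_riskE sigma_gt0 a_gt0 a_cvg0 n_gt0.
split=> // [m|m t mn E].
  by rewrite /optimal_allocation -riskE.
have [m_ge0 _] := mn.
rewrite -(minimax_pinsker sigma_gt0 a_gt0 a_cvg0 m_ge0 E) -riskE.
by split=> [[]|].
Qed.
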